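(* Let $\sigma$ be a probability measure on $\mathbb{R}$ with $\sigma(\{0\})<1$. Then for every odd integer $k\ge3$ for which $\int|x|^k d\sigma(x)<\infty$, $$n^0_\sigma(k)\ge\frac{\left(\int x^k d\sigma(x)\right)^{k-1}}{\left(\int x^{k-1}d\sigma(x)\right)^{k}}.$$
   Context: $n^0_\sigma(k)$ is the minimal $n$ for which there exist points $x_1,\dots,x_n\in\mathbb{R}$ (not necessarily distinct) with $\int x^j d\sigma(x)=\frac1n\sum_{i=1}^n x_i^j$ for all integers $0\le j\le k$, and $n^0_\sigma(k)=\infty$ if no such $n$ exists. *)

(* Defs.v *)
From mathcomp Require Import all_boot all_order all_algebra.
From mathcomp Require Import all_classical all_reals all_analysis.

Set Implicit Arguments.
Unset Strict Implicit.
Unset Printing Implicit Defensive.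

Import Order.TTheory GRing.Theory Num.Theory.
Import numFieldNormedType.Exports.

Local Open Scope classical_set_scope.
Local Open Scope ring_scope.

(* The moments are extended-real integrals and the averages are finite, so the
   equalities also force every moment involved to be finite. *)
Definition has_equal_weight_nodes (R : realType)
    (sigma : probability (measurableTypeR R) R) (k n : nat) : Prop :=
  (0 < n)%N /\
  exists x : 'I_n -> R, forall j : nat, (j <= k)%N ->
    (\int[sigma]_y ((y : R) ^+ j)%:E = (n%:R^-1 * \sum_(i < n) x i ^+ j)%:E)%E.

Definition n0 (R : realType) (sigma : probability (measurableTypeR R) R)
    (k : nat) : \bar R :=
  if pselect (exists n, `[< has_equal_weight_nodes sigma k n >]) is left ex
  then ((ex_minn ex)%:R)%:E
  else +oo%E.

(* Main.v *)
(* If the n equal-weight nodes x_i match the moments, then with M = max |x_i|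
   and S = sum x_i^(k-1) one has |sum x_i^k| <= M * S and M^(k-1) <= S, so
   (sum x_i^k)^(k-1) <= S^k; dividing the sums by n turns this into
   (k-th moment)^(k-1) <= n * ((k-1)-th moment)^k. *)
Require Import Defs.
From mathcomp Require Import all_boot all_order all_algebra.
From mathcomp Require Import all_classical all_reals all_analysis.

Set Implicit Arguments.
Unset Strict Implicit.
Unset Printing Implicit Defensive.

Import Order.TTheory GRing.Theory Num.Theory.
Import numFieldNormedType.Exports.

Local Open Scope classical_set_scope.
Local Open Scope ring_scope.

Lemma power_sum_le (R : realDomainType) (I : finType) (x : I -> R) (m : nat) :
  (0 < m)%N -> ~~ odd m ->
  (\sum_i x i ^+ m.+1) ^+ m <= (\sum_i x i ^+ m) ^+ m.+1.
Proof.
move=> m_gt0 m_even; set S := \sum_i x i ^+ m.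
have normX i : `|x i| ^+ m = x i ^+ m by rewrite -normrX ger0_norm ?exprn_even_ge0.
have S_ge0 : 0 <= S by apply: sumr_ge0 => i _; rewrite exprn_even_ge0.
(* A largest [|x i|] exists only for nonempty [I]; over an empty [I] the left side is [0 ^+ m = 0],
   as [0 < m]. *)
have [i0 _|I0] := pickP (@predT I); last first.
  by rewrite big_pred0 // expr0n gtn_eqF //= exprn_ge0.
case: (@arg_maxP _ R I i0 xpredT (fun i => `|x i|)) => // i _ le_xi.
have sum_le : `|\sum_j x j ^+ m.+1| <= `|x i| * S.
  rewrite mulr_sumr; apply: le_trans (ler_norm_sum _ _ _) (ler_sum _ _) => j _.
  by rewrite normrX exprS normX ler_wpM2r ?exprn_even_ge0 //; apply: le_xi.
(* For even [m] every term of [S] is nonnegative, so a single one is at most [S]. *)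
have max_le : `|x i| ^+ m <= S.
  rewrite normX /S (bigD1 i) //= lerDl.
  by apply: sumr_ge0 => j _; rewrite exprn_even_ge0.
apply: le_trans (ler_norm _) _; rewrite normrX.
apply: le_trans (lerXn2r m _ _ sum_le) _; rewrite ?nnegrE ?mulr_ge0 //.
by rewrite exprMn exprS ler_wpM2r ?exprn_ge0.
Qed.

(** The weight [n%:R^-1] enters [m] times above and [m.+1] times below, so the quotient is [n%:R]
    times a ratio of power sums that [power_sum_le] bounds by 1. If [n] or the lower sum is 0, the
    convention [0^-1 = 0] makes the quotient 0. *)
Lemma power_mean_ratio_le (R : realFieldType) (n : nat) (x : 'I_n -> R)
    (m : nat) :
  (0 < m)%N -> ~~ odd m ->
  (n%:R^-1 * \sum_i x i ^+ m.+1) ^+ m / (n%:R^-1 * \sum_i x i ^+ m) ^+ m.+1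
    <= n%:R.
Proof.
case: n x => [|n] x m_gt0 m_even.
  by rewrite !big_ord0 !mulr0 [0 ^+ m.+1]expr0n invr0 mulr0.
set S := \sum_i x i ^+ m.
have S_ge0 : 0 <= S by apply: sumr_ge0 => i _; rewrite exprn_even_ge0.
have [->|S_neq0] := eqVneq S 0.
  by rewrite mulr0 [0 ^+ m.+1]expr0n invr0 mulr0.
have nR_gt0 : 0 < n.+1%:R :> R by rewrite ltr0n.
have S_gt0 : 0 < S by rewrite lt_neqAle eq_sym S_neq0.
rewrite ler_pdivrMr ?exprn_gt0 ?mulr_gt0 ?invr_gt0 //.
rewrite !exprMn [n.+1%:R^-1 ^+ m.+1]exprS.
rewrite -mulrA mulVKf ?gt_eqF // ler_wpM2l ?exprn_ge0 ?invr_ge0 ?(ltW nR_gt0) //.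
exact: power_sum_le.
Qed.

Theorem theorem1p8 (R : realType) (sigma : probability (measurableTypeR R) R)
    (sigma_neq_dirac0 : (sigma [set 0%R : R] < 1)%E)
    (k : nat) (k_odd : odd k) (k_ge3 : (3 <= k)%N)
    (k_moment : (\int[sigma]_x (`|(x : R)| ^+ k)%:E < +oo)%E) :
  (((\int[sigma]_x ((x : R) ^+ k)) ^+ (k - 1)
    / (\int[sigma]_x ((x : R) ^+ (k - 1))) ^+ k)%:E <= n0 sigma k)%E.
Proof.
rewrite /n0; case: pselect => [ex|_]; last exact: leey.
(* The bound holds for every admissible [n], hence for the least one. *)
case: ex_minnP => n /asboolP[_ [x moments]] _.
(* The real integral is [fine] of the extended one, which [moments] equates with a finite
   average. *)
have momentE j : (j <= k)%N ->
    \int[sigma]_y ((y : R) ^+ j) = n%:R^-1 * \sum_(i < n) x i ^+ j.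
  by move=> le_jk; rewrite /Rintegral moments.
rewrite lee_fin !momentE ?leq_subr // subn1.
by case: k k_odd k_ge3 {k_moment ex moments momentE} => // m m_even m_ge2;
  apply: power_mean_ratio_le => //; exact: ltnW m_ge2.
Qed.
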